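(* Let $A$ be a polynomial ring in finitely many variables over a field $k$ with $\operatorname{char}(k)=0$, and let $I$ be a nonzero proper homogeneous ideal of $A$. Then $\partial(I^{(n)})\subseteq I^{(n-1)}$ for all $n\ge 1$. Therefore, the filtration $\{I^{(n)}\}_{n\ge 0}$ is Tor-vanishing, i.e. for all $n\ge 1$ and all $i\ge 0$ the map $\operatorname{Tor}_i^A(k,I^{(n)})\to \operatorname{Tor}_i^A(k,I^{(n-1)})$ induced by the inclusion $I^{(n)}\subseteq I^{(n-1)}$ is zero.
   Context: $A$ has the standard grading, and $k$ is regarded as the $A$-module $A/\mathfrak m$, with $\mathfrak m$ the ideal generated by the variables. For a homogeneous ideal $Q$ of $A$, $\partial(Q)$ denotes the ideal generated by the partial derivatives (with respect to all variables of $A$) of a set of (homogeneous) generators of $Q$; it does not depend on the choice of generators. For an ideal $Q$ of a Noetherian ring $S$ and $n\ge1$, the symbolic power is $Q^{(n)}=S\cap\bigcap_{P\in\operatorname{Min}(Q)}Q^nS_P$, where $\operatorname{Min}(Q)$ is the set of minimal primes of $Q$, and $Q^{(0)}=S$. *)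

(* Defs.v *)
From HB Require Import structures.
From mathcomp Require Import all_boot all_order all_algebra.
From mathcomp Require Import boolp classical_sets.
From mathcomp Require Import mpoly.

Set Implicit Arguments.
Unset Strict Implicit.
Unset Printing Implicit Defensive.

Import GRing.Theory.
Local Open Scope classical_set_scope.
Local Open Scope ring_scope.
Local Open Scope quotient_scope.

Section Modules.
Variables (S : nzRingType) (M : lmodType S) (N : submodClosed M).

Definition submodule : Type := {x : M | x \in N}.

HB.instance Definition _ := SubChoice.on submodule.
HB.instance Definition _ := [SubChoice_isSubLmodule of submodule by <:].

Lemma submodule_val_linear : linear (val : submodule -> M).
Proof. exact: linearP. Qed.

Lemma submodule_valB (x y : submodule) : val (x - y) = val x - val y.
Proof. exact: raddfB. Qed.

Definition submod_pred : {pred M} := fun x => x \in N.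

HB.instance Definition _ := GRing.isZmodClosed.Build M submod_pred
  (GRing.submod_closedB (submodClosedP N)).

Definition quotient_module : Type := Quotient.quot submod_pred.

HB.instance Definition _ := EqQuotient.on quotient_module.
HB.instance Definition _ := GRing.Zmodule.on quotient_module.

Lemma quotient_eq (u v : M) :
  (\pi_quotient_module u == \pi_quotient_module v) = (u - v \in N).
Proof. by rewrite -(Quotient.idealrBE submod_pred). Qed.

Definition quotient_scale (a : S) (x : quotient_module) : quotient_module :=
  \pi_quotient_module (a *: repr x).

Lemma quotient_scale_pi a (v : M) :
  quotient_scale a (\pi_quotient_module v) = \pi_quotient_module (a *: v).
Proof.
apply/eqP; rewrite quotient_eq -scalerBr; apply: rpredZ.
by rewrite -quotient_eq reprK.
Qed.

Lemma quotient_piD (u v : M) :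
  \pi_quotient_module (u + v) =
  \pi_quotient_module u + \pi_quotient_module v.
Proof. exact: (Quotient.pi_add submod_pred u v). Qed.

Fact quotient_scaleA a b x :
  quotient_scale a (quotient_scale b x) = quotient_scale (a * b) x.
Proof. by rewrite -[x]reprK (quotient_scale_pi b) !quotient_scale_pi scalerA. Qed.

Fact quotient_scale1 : left_id 1 quotient_scale.
Proof. by move=> x; rewrite -[x]reprK quotient_scale_pi scale1r. Qed.

Fact quotient_scaleDr : right_distributive quotient_scale +%R.
Proof.
move=> a x y; rewrite -[x]reprK -[y]reprK.
by rewrite -quotient_piD !quotient_scale_pi -quotient_piD scalerDr.
Qed.

Fact quotient_scaleDl x : {morph quotient_scale^~ x : a b / a + b}.
Proof.
move=> a b; rewrite -[x]reprK.
by rewrite !quotient_scale_pi -quotient_piD scalerDl.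
Qed.

HB.instance Definition _ := GRing.Zmodule_isLmodule.Build S quotient_module
  quotient_scaleA quotient_scale1 quotient_scaleDr quotient_scaleDl.

End Modules.

Section Inclusion.
Variables (S : nzRingType) (M : lmodType S) (N1 N2 : submodClosed M)
  (sub12 : {subset N1 <= N2}).

Definition inclusion (x : submodule N1) : submodule N2 :=
  exist (fun y => y \in N2) (val x) (sub12 (valP x)).

Fact inclusion_is_linear : linear inclusion.
Proof.
move=> a x y; apply: val_inj; rewrite submodule_val_linear /=.
exact: submodule_val_linear.
Qed.

HB.instance Definition _ :=
  GRing.isLinear.Build S (submodule N1) (submodule N2) _ inclusion
    inclusion_is_linear.
End Inclusion.

(* An ideal of a commutative ring S is a submodule of S^o, that is, a term of *)
(* type submodClosed S^o.                                                     *)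

Section Ideals.
Variable S : comNzRingType.
Implicit Types (X : set S) (Q P I : submodClosed S^o).

Definition ideal_gen X : {pred S^o} := fun x =>
  `[< exists s : seq (S * S),
        (forall u, u \in s -> X u.2) /\ x = \sum_(u <- s) u.1 * u.2 >].

Fact ideal_gen_closed X : submod_closed (ideal_gen X).
Proof.
split=> [|a x y /asboolP[s [sX ->]] /asboolP[t [tX ->]]]; apply/asboolP.
  by exists [::]; split=> //; rewrite big_nil.
exists ([seq (a * u.1, u.2) | u <- s] ++ t); split.
  by move=> u; rewrite mem_cat => /orP[/mapP[v /sX vX ->]|/tX].
rewrite big_cat big_map; congr (_ + _); rewrite scaler_sumr.
by apply: eq_bigr => u _; rewrite -mulrA.
Qed.

HB.instance Definition _ X :=
  GRing.isSubmodClosed.Build S S^o (ideal_gen X) (ideal_gen_closed X).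

Lemma mem_ideal_gen X x : X x -> x \in ideal_gen X.
Proof.
move=> Xx; apply/asboolP; exists [:: (1, x)]; split.
  by move=> u; rewrite inE => /eqP ->.
by rewrite big_seq1 mul1r.
Qed.

Lemma ideal_gen_min X I :
  (forall x, X x -> x \in I) -> {subset ideal_gen X <= I}.
Proof.
move=> XI x /asboolP[s [sX ->]]; rewrite big_seq.
by apply: rpred_sum => u /sX /XI uI; apply: (rpredZ u.1 uI).
Qed.

Definition ideal_pow Q n : {pred S^o} :=
  ideal_gen [set x | exists q : 'I_n -> S,
    (forall i, q i \in Q) /\ x = \prod_(i < n) q i].

HB.instance Definition _ Q n := GRing.SubmodClosed.on (ideal_pow Q n).

Lemma ideal_powS Q n : {subset ideal_pow Q n.+1 <= ideal_pow Q n}.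
Proof.
apply: ideal_gen_min => x [q [qQ ->]].
rewrite big_ord_recl; apply: (rpredZ (q ord0)); apply: mem_ideal_gen.
by exists (fun i => q (lift ord0 i)).
Qed.

Definition prime_ideal P : Prop := 1 \notin P /\ prime_idealr_closed P.

Definition minimal_prime Q P : Prop :=
  [/\ prime_ideal P, {subset Q <= P} &
      forall P' : submodClosed S^o, prime_ideal P' ->
        {subset Q <= P'} -> {subset P' <= P} -> {subset P <= P'}].

End Ideals.

(* S being a domain, its localization at a prime ideal P is realized inside   *)
(* its fraction field.                                                        *)
Section SymbolicPowers.
Variable S : idomainType.
Local Notation "x %:F" := (@FracField.tofrac S x).
Implicit Types (Q P : submodClosed S^o).

Definition localization P : set {fraction S} :=
  [set f | exists a s : S, s \notin P /\ f = a%:F / s%:F].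

(* The ideal Q S_P of S_P generated by the image of Q. *)
Definition localized_ideal Q P : set {fraction S} :=
  [set f | exists t : seq ({fraction S} * S),
     (forall u, u \in t -> localization P u.1 /\ u.2 \in Q) /\
     f = \sum_(u <- t) u.1 * u.2%:F].

Definition symbolic_power Q (n : nat) : {pred S^o} :=
  if n is 0 then predT else fun x =>
    `[< forall P, minimal_prime Q P ->
          localized_ideal (ideal_pow Q n) P x%:F >].

Fact symbolic_power_closed Q n : submod_closed (symbolic_power Q n).
Proof.
case: n => [|n]; first by split.
split=> [|a x y /asboolP xQ /asboolP yQ]; apply/asboolP => P minP.
  by exists [::]; split=> //; rewrite big_nil rmorph0.
have [s [sQ sE]] := xQ P minP; have [t [tQ tE]] := yQ P minP.
exists ([seq (a%:F * u.1, u.2) | u <- s] ++ t); split.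
  move=> u; rewrite mem_cat => /orP[/mapP[v /sQ[[b [c [cP vE]]] vQ] ->]|/tQ //].
  split=> //=; exists (a * b), c; split=> //.
  by rewrite vE rmorphM mulrA.
have -> : (a *: x + y)%:F = a%:F * x%:F + y%:F :> {fraction S}.
  by rewrite rmorphD rmorphM.
rewrite sE tE big_cat big_map; congr (_ + _); rewrite mulr_sumr.
by apply: eq_bigr => u _; rewrite mulrA.
Qed.

HB.instance Definition _ Q n := GRing.isSubmodClosed.Build S S^o
  (symbolic_power Q n) (symbolic_power_closed Q n).

Lemma symbolic_powerS Q n :
  {subset symbolic_power Q n.+1 <= symbolic_power Q n}.
Proof.
case: n => [//|n] x /asboolP xQ; apply/asboolP => P minP.
have [t [tQ tE]] := xQ P minP; exists t; split=> // u /tQ[uP uQ].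
by split=> //; apply: ideal_powS.
Qed.

End SymbolicPowers.

(* Tor_i^S(K, M) is the i-th homology of F (x) M, for F a resolution of K by  *)
(* finite free modules F_i = S^(b_i), which exists when S is Noetherian and K *)
(* is finitely generated. Linear maps between the F_i are matrices acting on  *)
(* row vectors on the right.                                                  *)
Record free_resolution (S : comNzRingType) (K : lmodType S) := FreeResolution {
  res_rank : nat -> nat;
  res_diff : forall i, 'M[S]_(res_rank i.+1, res_rank i);
  res_aug : {linear 'rV[S]_(res_rank 0) -> K};
  res_aug_surj : forall c, exists v, res_aug v = c;
  res_aug_exact : forall v, res_aug v = 0 <-> exists w, v = w *m res_diff 0;
  res_exact : forall i (v : 'rV_(res_rank i.+1)),
    v *m res_diff i = 0 <-> exists w, v = w *m res_diff i.+1
}.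

Section Tor.
Variables (S : comNzRingType) (K : lmodType S) (F : free_resolution K).

Section TorModule.
Variable M : lmodType S.

(* S^b (x) M = M^b *)
Definition res_tensor (i : nat) : Type := {ffun 'I_(res_rank F i) -> M}.

HB.instance Definition _ i := GRing.Lmodule.on (res_tensor i).

Definition tensor_diff (i : nat) (z : res_tensor i.+1) : res_tensor i :=
  [ffun j => \sum_l res_diff F i l j *: z l].

Fact tensor_diff_is_linear i : linear (@tensor_diff i).
Proof.
move=> a x y; apply/ffunP => j; rewrite !ffunE scaler_sumr -big_split /=.
by apply: eq_bigr => l _; rewrite !ffunE scalerDr !scalerA mulrC.
Qed.

HB.instance Definition _ i := GRing.isLinear.Build S (res_tensor i.+1)
  (res_tensor i) _ (@tensor_diff i) (@tensor_diff_is_linear i).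

Lemma tensor_diffK i (z : res_tensor i.+2) : tensor_diff (tensor_diff z) = 0.
Proof.
apply/ffunP => j; rewrite !ffunE.
under eq_bigr do rewrite ffunE scaler_sumr.
rewrite exchange_big big1 // => l _; under eq_bigr do rewrite scalerA mulrC.
rewrite -scaler_suml.
have /(congr1 (fun v : 'rV_(_) => v 0 j)) :
    row l (res_diff F i.+1) *m res_diff F i = 0.
  by apply/res_exact; exists (delta_mx 0 l); rewrite rowE.
by rewrite !mxE; under eq_bigr do rewrite !mxE; move=> ->; rewrite scale0r.
Qed.

Definition cycles (i : nat) : {pred res_tensor i} :=
  match i return {pred res_tensor i} with
  | 0 => predT
  | j.+1 => fun z => tensor_diff z == 0
  end.

Fact cycles_closed i : submod_closed (@cycles i).
Proof.
case: i => [|i]; first by split.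
split=> [|a x y]; first by rewrite unfold_in /= linear0.
rewrite !unfold_in /= => /eqP xE /eqP yE.
by rewrite linearP /= xE yE scaler0 addr0.
Qed.

HB.instance Definition _ i := GRing.isSubmodClosed.Build S (res_tensor i)
  (@cycles i) (cycles_closed i).

Definition boundaries (i : nat) : {pred submodule (@cycles i)} := fun z =>
  `[< exists w : res_tensor i.+1, val z = tensor_diff w >].

Fact boundaries_closed i : submod_closed (@boundaries i).
Proof.
split=> [|a x y /asboolP[u xE] /asboolP[v yE]]; apply/asboolP.
  by exists 0; rewrite !linear0.
by exists (a *: u + v); rewrite [RHS]linearP /= -xE -yE; apply: submodule_val_linear.
Qed.

HB.instance Definition _ i := GRing.isSubmodClosed.Build S
  (submodule (@cycles i)) (@boundaries i) (boundaries_closed i).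

Definition tor (i : nat) : Type := quotient_module (@boundaries i).

HB.instance Definition _ i := EqQuotient.on (tor i).
HB.instance Definition _ i := GRing.Lmodule.on (tor i).

End TorModule.

Section TorMap.
Variables (M N : lmodType S) (phi : {linear M -> N}) (i : nat).

Definition tensor_map j (z : res_tensor M j) : res_tensor N j :=
  [ffun l => phi (z l)].

Lemma tensor_map_diff j (z : res_tensor M j.+1) :
  tensor_diff (tensor_map z) = tensor_map (tensor_diff z).
Proof.
apply/ffunP => l; rewrite !ffunE linear_sum.
by apply: eq_bigr => ? _; rewrite ffunE linearZ.
Qed.

Fact tensor_map_cycle (z : submodule (@cycles M i)) :
  tensor_map (val z) \in @cycles N i.
Proof.
case: i z => [//|j] [z /=]; rewrite !unfold_in /= tensor_map_diff => /eqP ->.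
by apply/eqP/ffunP => l; rewrite !ffunE linear0.
Qed.

Definition cycle_map (z : submodule (@cycles M i)) : submodule (@cycles N i) :=
  exist (fun y => y \in @cycles N i) (tensor_map (val z)) (tensor_map_cycle z).

Definition tor_map (x : tor M i) : tor N i :=
  \pi_(tor N i) (cycle_map (repr x)).

Lemma tor_map_pi (z : submodule (@cycles M i)) :
  tor_map (\pi_(tor M i) z) = \pi_(tor N i) (cycle_map z).
Proof.
apply/eqP; rewrite quotient_eq.
have : repr (\pi_(tor M i) z) - z \in @boundaries M i.
  by rewrite -quotient_eq reprK.
move=> /asboolP[w wE]; apply/asboolP; exists (tensor_map w).
rewrite tensor_map_diff -wE !submodule_valB; apply/ffunP => l.
by rewrite !ffunE linearB.
Qed.

End TorMap.
End Tor.

Section PolynomialRing.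
Variables (k : fieldType) (m : nat).
Local Notation A := {mpoly k[m]}.
Implicit Types (G : set A) (Q : submodClosed A^o).

Definition homogeneous_set G : Prop :=
  forall g, G g -> exists d, g \is d.-homog.

Definition homogeneous_ideal Q : Prop :=
  exists G, homogeneous_set G /\ Q =i ideal_gen G.

Definition partials G : set A :=
  [set f | exists g i, G g /\ f = g^`M(i)].

(* Q is taken as a set of generators of itself; by partial_ideal_gen, in      *)
(* characteristic 0 any set of homogeneous generators of a proper ideal       *)
(* yields the same result.                                                    *)
Definition partial_ideal Q : {pred A^o} :=
  ideal_gen (partials [set f | f \in Q]).

HB.instance Definition _ Q := GRing.SubmodClosed.on (partial_ideal Q).

Lemma euler_homog d (p : A) :
  p \is d.-homog -> \sum_i 'X_i * p^`M(i) = d%:R * p.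
Proof.
move=> hp.
have pE i : 'X_i * p^`M(i) = \sum_(n <- msupp p | n \in msupp p)
                               (n i)%:R * (p@_n *: 'X_[n]).
  rewrite {1}(mpolyE p) big_seq raddf_sum mulr_sumr.
  apply: eq_bigr => n _ /=; rewrite mderivZ mderivX -!scalerAr.
  case: (posnP (n i)) => [->|ni]; first by rewrite scale0r mulr0n mul0r scaler0.
  rewrite -mpolyXD addmC submK; last by rewrite lep1mP -lt0n.
  by rewrite scaler_nat mulr_natl.
under eq_bigr do rewrite pE.
rewrite exchange_big /=.
under eq_bigr => n np do rewrite -mulr_suml -natr_sum -mdegE (dhomog_mf hp) //.
by rewrite -mulr_sumr -big_seq -mpolyE.
Qed.

Lemma partial_ideal_gen G :
  [pchar k] =i pred0 -> homogeneous_set G -> 1 \notin ideal_gen G ->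
  partial_ideal (ideal_gen G) =i ideal_gen (partials G).
Proof.
move=> char0 homG proper.
have partG g i : G g -> g^`M(i) \in ideal_gen (partials G).
  by move=> Gg; apply: mem_ideal_gen; exists g, i.
have subG g : G g -> g \in ideal_gen (partials G).
  move=> Gg; have [d hg] := homG g Gg.
  case: (posnP d) => [d0|d_gt0]; last first.
    have dN0 : d%:R != 0 :> k by move/pcharf0P: char0 => ->; rewrite -lt0n.
    have -> : g = d%:R^-1%:MP * \sum_i 'X_i * g^`M(i).
      by rewrite (euler_homog hg) -mpolyC_nat mulrA -mpolyCM mulVf // mul1r.
    apply: (rpredZ (_ : A)); apply: rpred_sum => i _.
    by apply: (rpredZ ('X_i : A)); apply: partG.
  have gE : g = (g@_0)%:MP.
    apply/mpolyP => n; rewrite mcoeffC; case: eqVneq => [->|n0].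
      by rewrite mulr1.
    by rewrite mulr0 (dhomog_nemf_coeff hg) // d0 mdeg_eq0.
  have [g0|gN0] := eqVneq (g@_0) 0; first by rewrite gE g0 rpred0.
  case/negP: proper; have -> : 1 = (g@_0)^-1%:MP * g :> A.
    by rewrite {2}gE -mpolyCM mulVf.
  by apply: (rpredZ (_ : A)); apply: mem_ideal_gen.
move=> x; apply/idP/idP; apply: ideal_gen_min => {}x [g [i [gG ->]]]; last first.
  by apply: mem_ideal_gen; exists g, i; split=> //; apply: mem_ideal_gen.
case/asboolP: gG => s [sG ->]; rewrite big_seq raddf_sum.
apply: rpred_sum => u /sG uG /=; rewrite mderivM.
by apply: rpredD; [apply: (rpredZ (_ : A)); apply: subG |
                   apply: (rpredZ (_ : A)); apply: partG].
Qed.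

Definition irrelevant_ideal : {pred A^o} :=
  ideal_gen [set f | exists i : 'I_m, f = 'X_i].

HB.instance Definition _ := GRing.SubmodClosed.on irrelevant_ideal.

(* The field k, as the A-module A/m with m the ideal of the variables. *)
Definition residue_module := quotient_module irrelevant_ideal.

(* The choice of F is immaterial; the condition is required for all of them. *)
Definition tor_vanishing (J : nat -> submodClosed A^o)
    (dec : forall n, {subset J n.+1 <= J n}) : Prop :=
  forall (F : free_resolution residue_module) (n i : nat)
         (x : tor F (submodule (J n.+1)) i),
    tor_map (inclusion (dec n)) x = 0.

End PolynomialRing.

(* Main.v *)
(** If [s x] lies in [I^n] with [s] outside a minimal prime [P], then
    [s^2 delta x = s delta (s x) - delta s (s x)] lies in the ordinary power
    of exponent [n-1] for every derivation [delta], and even in [I^n] when [delta] is the Euler derivation,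
    which preserves the homogeneous ideal [I].  This gives
    [partial I^(n) <= I^(n-1)] and the Euler-stability of [I^(n)].

    Tor is computed with the Koszul complex.  With the de Rham differential [d]
    and the Koszul differential [kappa], [kappa d + d kappa] multiplies by the
    total degree.  On a Koszul cycle with coefficients in [I^(n)], [kappa d] is
    thus the total degree, and [d] lands in coefficients in [I^(n-1)], so in
    characteristic 0 a cycle without component of total degree 0 is a boundary
    over [I^(n-1)].  Degree 0 does not occur because [I^(n)] lies in a minimal
    prime contained in the irrelevant ideal.  The same argument over [A] shows
    that the Koszul complex is a resolution, and comparison of resolutions
    transfers the vanishing to any other one. *)

Require Import Defs.
From HB Require Import structures.
From mathcomp Require Import all_boot all_order all_algebra.
From mathcomp Require Import boolp classical_sets.
From mathcomp Require Import mpoly.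

Set Implicit Arguments.
Unset Strict Implicit.
Unset Printing Implicit Defensive.

Import GRing.Theory.
Local Open Scope ring_scope.

(** * Comparison of resolutions *)

(** Chain maps and homotopies are built degree by degree; [good] is the invariant that makes the
    next degree solvable, [P] the relation wanted between neighbours. *)
Lemma dependent_choice_nat (T : nat -> Type) (good : forall i, T i -> Prop)
    (P : forall i, T i -> T i.+1 -> Prop) :
  (exists x, @good 0%N x) ->
  (forall i x, @good i x -> exists2 y, P i x y & good i.+1 y) ->
  exists2 f : forall i, T i, @good 0%N (f 0%N) & forall i, P i (f i) (f i.+1).
Proof.
move=> /cid[x0 good0] step.
pose next i (x : {x : T i | good i x}) : {y : T i.+1 | good i.+1 y} :=
  let: exist2 y _ gy := cid2 (step i (sval x) (svalP x)) in exist _ y gy.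
pose f := fix f i : {x : T i | good i x} :=
  if i is j.+1 then next j (f j) else exist _ x0 good0.
exists (fun i => sval (f i)) => // i.
by rewrite /= /next; case: cid2.
Qed.

Lemma submodule_val_sum (S : nzRingType) (M : lmodType S) (N : submodClosed M)
    (J : finType) (a : J -> S) (z : J -> submodule N) :
  val (\sum_j a j *: z j) = \sum_j a j *: val (z j).
Proof.
by elim/big_rec2: _ => [//|j x y _ <-]; apply: submodule_val_linear.
Qed.

Section TensorMatrix.
Variables (S : comNzRingType) (M : lmodType S).

(** This is [X] tensored with [M]. For [X = res_diff F i] it is convertible to [tensor_diff]. *)
Definition tensor_mx p q (X : 'M[S]_(p, q)) (z : {ffun 'I_p -> M}) :
    {ffun 'I_q -> M} :=
  [ffun j => \sum_l X l j *: z l].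

Lemma tensor_mxM p q r (X : 'M_(p, q)) (Y : 'M_(q, r)) z :
  tensor_mx (X *m Y) z = tensor_mx Y (tensor_mx X z).
Proof.
apply/ffunP => j; rewrite !ffunE.
under [RHS]eq_bigr do rewrite ffunE scaler_sumr.
rewrite exchange_big; apply: eq_bigr => l _ /=.
rewrite mxE scaler_suml; apply: eq_bigr => t _.
by rewrite scalerA mulrC.
Qed.

Lemma tensor_mxD p q (X Y : 'M_(p, q)) z :
  tensor_mx (X + Y) z = tensor_mx X z + tensor_mx Y z.
Proof.
apply/ffunP => j; rewrite !ffunE -big_split /=.
by apply: eq_bigr => l _; rewrite mxE scalerDl.
Qed.

Lemma tensor_mx1 p (z : {ffun 'I_p -> M}) : tensor_mx 1%:M z = z.
Proof.
apply/ffunP => j; rewrite !ffunE (bigD1 j) //= big1 ?addr0 ?mxE ?eqxx ?scale1r //.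
by move=> l /negPf lj; rewrite mxE lj scale0r.
Qed.

Lemma tensor_mx_r0 p q (X : 'M_(p, q)) : tensor_mx X 0 = 0.
Proof. by apply/ffunP => j; rewrite !ffunE big1 // => l _; rewrite ffunE scaler0. Qed.

End TensorMatrix.

Lemma tensor_map_mx (S : comNzRingType) (K M N : lmodType S)
    (F F' : free_resolution K) (phi : {linear M -> N}) i j
    (X : 'M_(res_rank F i, res_rank F' j)) (z : res_tensor F M i) :
  tensor_map phi (tensor_mx X z : res_tensor F' M j) =
  tensor_mx X (tensor_map phi z : res_tensor F N i).
Proof.
apply/ffunP => l; rewrite !ffunE linear_sum.
by apply: eq_bigr => t _; rewrite linearZ ffunE.
Qed.

Section ResolutionLift.
Variables (S : comNzRingType) (K : lmodType S).

(** The augmentation plays the role of the differential leaving degree 0, so that exactness reads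
    the same in all degrees. *)
Definition res_cycle (F : free_resolution K) i : 'rV_(res_rank F i) -> Prop :=
  match i with
  | 0 => fun v => res_aug F v = 0
  | j.+1 => fun v => v *m res_diff F j = 0
  end.

Lemma res_cycleP (F : free_resolution K) i (v : 'rV_(res_rank F i)) :
  res_cycle v <-> exists w, v = w *m res_diff F i.
Proof. by case: i v => [|i] v; [apply: res_aug_exact | apply: res_exact]. Qed.

Lemma res_diff_cycle (F : free_resolution K) i w : res_cycle (w *m res_diff F i).
Proof. by apply/res_cycleP; exists w. Qed.

Lemma res_diffM (F : free_resolution K) i :
  res_diff F i.+1 *m res_diff F i = 0.
Proof.
apply/row_matrixP => l; rewrite row_mul row0 rowE.
exact: (@res_diff_cycle F i.+1 (delta_mx 0 l)).
Qed.

(** Projectivity of a free module: each row of [X] is a cycle and is lifted on its own. *)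
Lemma res_lift (F : free_resolution K) i p (X : 'M_(p, res_rank F i)) :
  (forall w, res_cycle (w *m X)) -> exists Y, X = Y *m res_diff F i.
Proof.
move=> cX; have /choice[y yE] (l : 'I_p) : exists w, row l X = w *m res_diff F i.
  by apply/res_cycleP; rewrite rowE.
exists (\matrix_l y l); apply/row_matrixP => l.
by rewrite row_mul rowK yE.
Qed.

Lemma res_chain_map (F F' : free_resolution K) :
  exists2 f : forall i, 'M_(res_rank F i, res_rank F' i),
    forall v, res_aug F' (v *m f 0%N) = res_aug F v &
    forall i, res_diff F i *m f i = f i.+1 *m res_diff F' i.
Proof.
(* The first clause is what [res_lift] needs to produce [f i.+1]; the second carries the
   compatibility with the augmentations out of degree 0. *)
pose good i (f : 'M_(res_rank F i, res_rank F' i)) :=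
  (forall w, res_cycle (w *m res_diff F i *m f)) /\
  (match i return 'M_(res_rank F i, res_rank F' i) -> Prop with
   | 0 => fun f => forall v, res_aug F' (v *m f) = res_aug F v
   | _ => fun=> True end) f.
have [||f [_ f0] fS] := @dependent_choice_nat
    (fun i => 'M_(res_rank F i, res_rank F' i)) good
    (fun i f f' => res_diff F i *m f = f' *m res_diff F' i).
- have /choice[y yE] (l : 'I_(res_rank F 0)) :
    exists w, res_aug F' w = res_aug F (delta_mx 0 l) by apply: res_aug_surj.
  have aug0 v : res_aug F' (v *m \matrix_l y l) = res_aug F v.
    rewrite [v in RHS]row_sum_delta mulmx_sum_row !linear_sum.
    by apply: eq_bigr => l _; rewrite !linearZ rowK yE.
  exists (\matrix_l y l); split=> // w; rewrite /res_cycle aug0.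
  exact: (res_diff_cycle w).
- move=> i f [cf _]; have [|f' f'E] := @res_lift F' i _ (res_diff F i *m f).
    by move=> w; rewrite mulmxA.
  exists f' => //; split=> // w.
  by rewrite /res_cycle -mulmxA -f'E mulmxA -(mulmxA w) res_diffM mulmx0 mul0mx.
by exists f.
Qed.

Lemma res_null_homotopy (F : free_resolution K)
    (e : forall i, 'M_(res_rank F i)) :
  (forall v, res_aug F (v *m e 0%N) = 0) ->
  (forall i, res_diff F i *m e i = e i.+1 *m res_diff F i) ->
  exists h : forall i, 'M_(res_rank F i, res_rank F i.+1),
    e 0%N = h 0%N *m res_diff F 0 /\
    forall i, e i.+1 = res_diff F i *m h i + h i.+1 *m res_diff F i.+1.
Proof.
move=> aug0 eS.
(* As [e] is a chain map, the first clause says that [e i.+1 - res_diff F i *m h] is a cycle, so it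
   lifts to the next [h]. *)
pose good i (h : 'M_(res_rank F i, res_rank F i.+1)) :=
  res_diff F i *m (e i - h *m res_diff F i) = 0 /\
  (match i return 'M_(res_rank F i, res_rank F i.+1) -> Prop with
   | 0 => fun h => e 0%N = h *m res_diff F 0
   | _ => fun=> True end) h.
have [||h [_ h0] hS] := @dependent_choice_nat
    (fun i => 'M_(res_rank F i, res_rank F i.+1)) good
    (fun i h h' => e i.+1 = res_diff F i *m h + h' *m res_diff F i.+1).
- have [//|h hE] := @res_lift F 0 _ (e 0%N).
  by exists h; split; rewrite // -hE subrr mulmx0.
- move=> i h [hE _].
  have [|h' h'E] := @res_lift F i.+1 _ (e i.+1 - res_diff F i *m h).
    move=> w; rewrite /res_cycle -mulmxA mulmxBl -eS -mulmxA -mulmxBr hE.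
    by rewrite mulmx0.
  exists h'; first by rewrite -h'E addrC subrK.
  split=> //; rewrite -h'E opprB addrC subrK mulmxA res_diffM.
  exact: mul0mx.
by exists h.
Qed.

End ResolutionLift.

Section TorZero.
Local Open Scope quotient_scope.
Variables (S : comNzRingType) (K M N : lmodType S) (phi : {linear M -> N}).

Lemma tor_map_eq0P (F : free_resolution K) i :
  (forall x : tor F M i, tor_map phi x = 0) <->
  (forall z : res_tensor F M i, z \in @cycles _ _ F M i ->
     exists w : res_tensor F N i.+1, tensor_map phi z = tensor_diff w).
Proof.
have pi0 : 0 = \pi_(tor F N i) 0.
  by apply/esym; apply: (addIr (\pi_(tor F N i) 0)); rewrite -quotient_piD !add0r.
split=> [tor0 z zc|bd x].
  have /eqP := tor0 (\pi_(tor F M i) (exist _ z zc)).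
  rewrite tor_map_pi pi0 quotient_eq subr0 => /asboolP[w wE].
  by exists w.
rewrite -[x]reprK tor_map_pi pi0; apply/eqP; rewrite quotient_eq subr0.
by apply/asboolP; apply: bd; apply: valP.
Qed.

(** With [f] and [g] comparison maps between the resolutions, [f] followed by [g] is homotopic to
    the identity. A cycle [z] is thus [g (f z)] plus a boundary, and [f z] is a cycle over [F'], to
    which the hypothesis applies. *)
Lemma tor_map_eq0_resolution (F F' : free_resolution K) i :
  (forall x : tor F' M i, tor_map phi x = 0) ->
  forall x : tor F M i, tor_map phi x = 0.
Proof.
move=> /tor_map_eq0P tor0; apply/tor_map_eq0P => z zc.
have [f f0 fS] := res_chain_map F F'; have [g g0 gS] := res_chain_map F' F.
have [|j|h [h0 hS]] := @res_null_homotopy _ _ F (fun j => 1%:M - f j *m g j).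
- by move=> v; rewrite mulmxBr mulmx1 linearB /= mulmxA g0 f0 subrr.
- rewrite mulmxBr mulmxBl mulmx1 mul1mx mulmxA fS -mulmxA gS mulmxA.
  by [].
have {h0 hS} [w0 zE] : exists w0 : res_tensor F M i.+1,
    z = tensor_mx (g i) (tensor_mx (f i) z) + tensor_diff w0.
  exists (tensor_mx (h i) z).
  rewrite -[LHS]tensor_mx1 -[1%:M](subrK (f i *m g i)) tensor_mxD addrC tensor_mxM.
  congr (_ + _); case: i z zc {tor0} => [|i] z zc; first by rewrite h0 tensor_mxM.
  rewrite hS tensor_mxD !tensor_mxM -[RHS]add0r; congr (_ + _).
  by have /eqP -> : tensor_mx (res_diff F i) z == 0 by []; rewrite tensor_mx_r0.
have [|w wE] := tor0 (tensor_mx (f i) z).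
  case: i z zc {w0 zE tor0} => [//|i] z zc; rewrite unfold_in /=.
  rewrite -[tensor_diff _]/(tensor_mx (res_diff F' i) (tensor_mx (f i.+1) z)).
  rewrite -tensor_mxM -fS tensor_mxM.
  by have /eqP -> : tensor_mx (res_diff F i) z == 0 by []; rewrite tensor_mx_r0.
exists (tensor_mx (g i.+1) w + tensor_map phi w0).
rewrite linearD /= tensor_map_diff [in LHS]zE.
have -> u v : tensor_map phi (u + v : res_tensor F M i) =
    tensor_map phi u + tensor_map phi v :> res_tensor F N i.
  by apply/ffunP => l; rewrite !ffunE linearD.
congr (_ + _); rewrite tensor_map_mx wE.
by rewrite -[LHS]tensor_mxM gS tensor_mxM.
Qed.

End TorZero.

(** * Derivations and symbolic powers *)

Section Derivations.
Variable S : comNzRingType.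
Implicit Types (Q J : submodClosed S^o) (delta : S -> S).

Definition derivation delta :=
  {morph delta : x y / x + y} /\
  forall x y, delta (x * y) = delta x * y + x * delta y.

Lemma mem_ideal_mul J a x : x \in J -> a * x \in J.
Proof. exact: (rpredZ (a : S)). Qed.

(** By the Leibniz rule [delta (a * x)] involves both [x] and [delta x], hence the two conditions on
    generators. *)
Lemma derivation_ideal_gen delta (X : set S) J : derivation delta ->
  (forall x, X x -> x \in J) -> (forall x, X x -> delta x \in J) ->
  forall x, x \in ideal_gen X -> delta x \in J.
Proof.
move=> [dD dM] XJ dXJ _ /asboolP[s [sX ->]].
have d0 : delta 0 = 0 by apply: (addIr (delta 0)); rewrite -dD !add0r.
rewrite (big_morph delta dD d0) big_seq; apply: rpred_sum => u /sX uX.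
by rewrite dM; apply: rpredD; apply: mem_ideal_mul; auto.
Qed.

Lemma ideal_powM Q n q x :
  q \in Q -> x \in ideal_pow Q n -> q * x \in ideal_pow Q n.+1.
Proof.
move=> qQ /asboolP[s [sX ->]]; rewrite mulr_sumr big_seq.
apply: rpred_sum => u /sX[p [pQ ->]]; rewrite mulrCA.
apply: mem_ideal_mul; apply: mem_ideal_gen.
(* The factors [p] shifted by one index, with [q] put at index 0. *)
exists (fun i => oapp p q (unlift ord0 i)); split.
  by move=> i; case: unliftP => [j _|_] /=.
rewrite big_ord_recl unlift_none; congr (_ * _).
by apply: eq_bigr => i _; rewrite liftK.
Qed.

Lemma ideal_pow0 Q x : x \in ideal_pow Q 0.
Proof.
rewrite -[x]mulr1; apply: mem_ideal_mul; apply: mem_ideal_gen.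
by exists (fun=> 0); split=> [[]|] //; rewrite big_ord0.
Qed.

Lemma ideal_pow_sub Q n : {subset ideal_pow Q n.+1 <= Q}.
Proof.
apply: ideal_gen_min => x [q [qQ ->]].
by rewrite big_ord_recl mulrC; apply: mem_ideal_mul.
Qed.

(** In [delta q * y + q * delta y], the first term loses only the factor [q], and the second loses
    one factor of [y] by induction. *)
Lemma derivation_ideal_pow delta Q n : derivation delta ->
  forall x, x \in ideal_pow Q n.+1 -> delta x \in ideal_pow Q n.
Proof.
move=> dd; elim: n => [|n IHn]; first by move=> x _; apply: ideal_pow0.
apply: derivation_ideal_gen => // x [q [qQ ->]].
  by apply: ideal_powS; apply: mem_ideal_gen; exists q.
have yP : \prod_(i < n.+1) q (lift ord0 i) \in ideal_pow Q n.+1.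
  by apply: mem_ideal_gen; exists (fun i => q (lift ord0 i)).
rewrite big_ord_recl dd.2; apply: rpredD; first exact: mem_ideal_mul.
by apply: ideal_powM => //; apply: IHn.
Qed.

Lemma derivation_ideal_pow_stable delta Q n : derivation delta ->
  (forall x, x \in Q -> delta x \in Q) ->
  forall x, x \in ideal_pow Q n -> delta x \in ideal_pow Q n.
Proof.
move=> dd dQ; elim: n => [|n IHn]; first by move=> x _; apply: ideal_pow0.
apply: derivation_ideal_gen => // x [q [qQ ->]].
  by apply: mem_ideal_gen; exists q.
have yP : \prod_(i < n) q (lift ord0 i) \in ideal_pow Q n.
  by apply: mem_ideal_gen; exists (fun i => q (lift ord0 i)).
rewrite big_ord_recl dd.2; apply: rpredD; apply: ideal_powM; auto.
Qed.

Lemma prime_notinM (P : submodClosed S^o) s t :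
  prime_ideal P -> s \notin P -> t \notin P -> s * t \notin P.
Proof. by move=> [_ Pp] sP tP; apply/negP => /Pp; rewrite (negPf sP) (negPf tP). Qed.

End Derivations.

Section DerivationSymbolicPower.
Variable S : idomainType.
Implicit Types (Q P J : submodClosed S^o) (delta : S -> S).
Local Notation "x %:F" := (@FracField.tofrac S x).

Lemma localized_idealP J P x : prime_ideal P ->
  localized_ideal J P x%:F <-> exists2 s, s \notin P & s * x \in J.
Proof.
move=> Pp; have nz s : s \notin P -> s%:F != 0.
  by move=> sP; rewrite tofrac_eq0; apply: contraNneq sP => ->; apply: rpred0.
split=> [[t [tJ xE]]|[s sP sxJ]]; last first.
  exists [:: (1%:F / s%:F, s * x)]; split=> [u|].
    by rewrite inE => /eqP->; split=> //; exists 1, s.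
  by rewrite big_seq1 /= tofracM tofrac1 mul1r mulKf ?nz.
(* A common denominator [s] is accumulated along the sum; it stays outside [P] because [P] is
   prime. *)
have [s sP [y yJ yE]] : exists2 s, s \notin P &
    exists2 y, y \in J & x%:F * s%:F = y%:F.
  rewrite xE {x xE}; elim: t tJ => [_|[f q] t IHt tJ].
    by exists 1; [exact: Pp.1 | exists 0; rewrite ?rpred0 // big_nil mul0r tofrac0].
  have [|s sP [y yJ yE]] := IHt; first by move=> u ut; apply: tJ; rewrite inE ut orbT.
  have [[a [c [cP /= fE]]] /= qJ] := tJ _ (mem_head _ _).
  exists (s * c); first exact: prime_notinM.
  exists (s * a * q + c * y); first by apply: rpredD; apply: mem_ideal_mul.
  rewrite big_cons /= tofracD !tofracM -yE fE mulrDl -!mulrA; congr (_ + _); last first.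
    by rewrite [RHS]mulrCA [c%:F * _]mulrC.
  rewrite [s%:F * c%:F]mulrC [q%:F * _]mulrCA mulKf ?nz //.
  by rewrite [RHS]mulrCA [s%:F * _]mulrC.
exists s => //; suff -> : s * x = y by [].
by apply/eqP; rewrite -(@tofrac_eq S) (@tofracM S) mulrC yE.
Qed.

Lemma symbolic_powerP Q n x : x \in symbolic_power Q n.+1 <->
  forall P, minimal_prime Q P -> exists2 s, s \notin P & s * x \in ideal_pow Q n.+1.
Proof.
split=> [/asboolP xQ P mP|xQ]; last apply/asboolP => P mP.
  by apply/localized_idealP; [case: mP | apply: xQ].
by apply/localized_idealP; [case: mP | apply: xQ].
Qed.

Lemma symbolic_power_sub_minimal_prime Q P n :
  minimal_prime Q P -> {subset symbolic_power Q n.+1 <= P}.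
Proof.
move=> mP x /symbolic_powerP/(_ P mP)[s sP /ideal_pow_sub sxQ].
have [[_ Pp] QP _] := mP.
by have /QP/Pp := sxQ; rewrite (negPf sP).
Qed.

(** The two exponents cover both uses: [a = b.+1] for partial derivatives and [a = b] for the Euler
    derivation. *)
Lemma derivation_symbolic_power delta Q a b : derivation delta ->
  {subset ideal_pow Q a.+1 <= ideal_pow Q b.+1} ->
  (forall x, x \in ideal_pow Q a.+1 -> delta x \in ideal_pow Q b.+1) ->
  forall x, x \in symbolic_power Q a.+1 -> delta x \in symbolic_power Q b.+1.
Proof.
move=> [dD dM] ab dab x /symbolic_powerP xQ; apply/symbolic_powerP => P mP.
have [s sP sx] := xQ P mP; exists (s * s).
  by apply: prime_notinM => //; case: mP.
have -> : s * s * delta x = s * delta (s * x) - delta s * (s * x).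
  by rewrite dM mulrDr !mulrA [s * delta s]mulrC addrAC subrr add0r.
by apply: rpredB; apply: mem_ideal_mul; [apply: dab | apply: ab].
Qed.

End DerivationSymbolicPower.

(** * Minimal primes below a given prime *)

Section MinimalPrime.
Variable S : comNzRingType.
Implicit Types (Q P : submodClosed S^o).

Definition ideal_inter (C : set (submodClosed S^o)) : {pred S^o} :=
  fun x => `[< forall P : submodClosed S^o, C P -> x \in P >].

Fact ideal_inter_closed C : submod_closed (ideal_inter C).
Proof.
split=> [|a x y /asboolP xC /asboolP yC]; apply/asboolP => P CP.
  exact: rpred0.
by apply: rpredD; [apply: rpredZ; apply: xC | apply: yC].
Qed.

HB.instance Definition _ C := GRing.isSubmodClosed.Build S S^o
  (ideal_inter C) (ideal_inter_closed C).

(** If [x] is outside [P] and [y] is outside [P'], the smaller of these two primes contains neither,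
    hence not [x * y]. *)
Lemma ideal_inter_prime (C : set (submodClosed S^o)) P0 : C P0 ->
  (forall P, C P -> prime_ideal P) ->
  (forall P P', C P -> C P' -> {subset P <= P'} \/ {subset P' <= P}) ->
  prime_ideal (ideal_inter C).
Proof.
move=> CP0 Cp Ctot; split.
  by apply/negP => /asboolP/(_ P0 CP0); apply/negP; case: (Cp P0 CP0).
move=> x y /asboolP xyC; apply/orP; apply: contrapT => /not_orP[xC yC].
case: xC; apply/asboolP => P CP; apply: contrapT => /negP xP.
case: yC; apply/asboolP => P' CP'; apply: contrapT => /negP yP'.
have [PP'|P'P] := Ctot P P' CP CP'.
- have yP : y \notin P by apply: contra yP' => /PP'.
  by have := prime_notinM (Cp P CP) xP yP; rewrite xyC.
- have xP' : x \notin P' by apply: contra xP => /P'P.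
  by have := prime_notinM (Cp P' CP') xP' yP'; rewrite xyC.
Qed.

(** Zorn's lemma for reverse inclusion on the primes between [Q] and [P0]. *)
Lemma exists_minimal_prime Q P0 : prime_ideal P0 -> {subset Q <= P0} ->
  exists2 P, minimal_prime Q P & {subset P <= P0}.
Proof.
move=> P0p QP0.
pose over P := [/\ prime_ideal P, {subset Q <= P} & {subset P <= P0}].
have over0 : over P0 by split.
pose R (P P' : {P | over P}) : bool := `[< {subset sval P' <= sval P} >].
have [|r s t /asboolP rs /asboolP st|C Ctot|P Pmin] :=
    @ZL_preorder _ (exist _ P0 over0) R.
- by move=> P; apply/asboolP.
- by apply/asboolP => x /st /rs.
(* The empty chain is bounded by [P0], a nonempty one by its intersection. *)
- have [[P1 CP1]|noC] := pselect (exists T, C T); last first.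
    by exists (exist _ P0 over0) => s Cs; case: noC; exists s.
  pose D P := exists2 T, C T & sval T = P.
  have oD : over (ideal_inter D).
    split; first apply: (@ideal_inter_prime D (sval P1)).
    + by exists P1.
    + by move=> _ [P' _ <-]; case: (svalP P').
    + move=> _ _ [P' CP' <-] [P'' CP'' <-].
      by case: (Ctot _ _ CP' CP'') => /asboolP; [right | left].
    + move=> x xQ; apply/asboolP => _ [P' _ <-].
      by case: (svalP P') => _ + _; apply.
    + move=> x /asboolP/(_ (sval P1)) xP1; case: (svalP P1) => _ _; apply.
      by apply: xP1; exists P1.
  exists (exist _ _ oD) => s Cs; apply/asboolP => x /asboolP; apply.
  by exists s.
exists (sval P); last by case: (svalP P).
case: (svalP P) => Pp QP PP0; split=> // P' P'p QP' P'P.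
have oP' : over P' by split=> // x /P'P /PP0.
exact/asboolP/(Pmin (exist _ P' oP'))/asboolP.
Qed.

End MinimalPrime.

(** * The Euler derivation and the irrelevant ideal *)

Section Euler.
Variables (k : fieldType) (m : nat).
Local Notation A := {mpoly k[m]}.

Lemma mderiv_derivation (i : 'I_m) : derivation (@mderiv m k i).
Proof. by split=> x y; [apply: mderivD | apply: mderivM]. Qed.

Definition euler (p : A) : A := \sum_i 'X_i * p^`M(i).

Lemma eulerD : {morph euler : p q / p + q}.
Proof.
move=> p q; rewrite -big_split; apply: eq_bigr => i _ /=.
by rewrite mderivD mulrDr.
Qed.

Lemma eulerM p q : euler (p * q) = euler p * q + p * euler q.
Proof.
rewrite mulr_suml mulr_sumr -big_split; apply: eq_bigr => i _ /=.
by rewrite mderivM mulrDr !mulrA [p * 'X_i]mulrC.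
Qed.

Lemma euler_derivation : derivation euler.
Proof. by split; [apply: eulerD | apply: eulerM]. Qed.

Lemma mcoeff_euler (p : A) n : (euler p)@_n = (mdeg n)%:R * p@_n.
Proof.
elim/mpolyind: p => [|c n' p _ _ IHp].
  by rewrite /euler big1 ?mcoeff0 ?mulr0 // => i _; rewrite mderiv0 mulr0.
rewrite eulerD !mcoeffD mulrDr IHp; congr (_ + _).
rewrite /euler (@euler_homog _ _ (mdeg n')); last first.
  by rewrite rpredZ // dhomogX.
rewrite -mpolyC_nat mcoeffCM mcoeffZ mcoeffX.
by case: eqVneq => [->//|_]; rewrite !mulr0.
Qed.

(** Every monomial other than 1 is divisible by a variable. Primality follows, the constant
    coefficient being a ring morphism to a field. *)
Lemma irrelevant_idealP (p : A) : (p \in @irrelevant_ideal k m) = (p@_0 == 0).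
Proof.
apply/idP/eqP => [/asboolP[s [sX ->]]|p0].
  rewrite rmorph_sum big_seq big1 // => u /sX[i ->] /=.
  by rewrite rmorphM /= mcoeffX mnm1_eq0 mulr0.
rewrite [p]mpolyE big_seq; apply: rpred_sum => n.
rewrite mcoeff_msupp => pn; have /existsP[i ni] : [exists i, n i != 0%N].
  rewrite -negb_forall; apply: contra_neqN pn => /forallP n0.
  suff -> : n = 0%MM by [].
  by apply/mnmP => i; rewrite mnm0E; apply/eqP.
have -> : 'X_[n] = 'X_[n - U_(i)] * 'X_i :> A.
  by rewrite -mpolyXD submK // lep1mP.
rewrite scalerAl; apply: mem_ideal_mul; apply: mem_ideal_gen.
by exists i.
Qed.

Lemma irrelevant_ideal_prime : prime_ideal (@irrelevant_ideal k m).
Proof.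
split=> [|x y]; first by rewrite irrelevant_idealP mcoeff1 eqxx oner_eq0.
by rewrite !irrelevant_idealP rmorphM mulf_eq0.
Qed.

End Euler.

(** * The Koszul complex *)

(** Terms below the diagonal cancel those above it. On the diagonal antisymmetry only gives that
    twice the term is 0, hence the second hypothesis. *)
Lemma sum_antisym (n : nat) (V : zmodType) (F : 'I_n -> 'I_n -> V) :
  (forall j l, F j l = - F l j) -> (forall j, F j j = 0) ->
  \sum_j \sum_l F j l = 0.
Proof.
move=> Fanti F0.
have -> : \sum_j \sum_l F j l =
    \sum_(j < n) \sum_(l : 'I_n | (l < j)%N) F j l +
      \sum_(j < n) \sum_(l : 'I_n | (j < l)%N) F j l.
  rewrite -big_split; apply: eq_bigr => j _ /=.
  rewrite (bigD1 j) //= F0 add0r (bigID (fun l : 'I_n => l < j)%N) /=.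
  by congr (_ + _); apply: eq_bigl => l; rewrite -val_eqE /=; case: ltngtP.
rewrite [X in X + _](exchange_big_dep predT) //= -big_split big1 //= => j _.
rewrite -big_split big1 //= => l _.
by rewrite Fanti addNr.
Qed.

Lemma sign_lt_anti (R : pzRingType) n (j l : 'I_n) : l != j ->
  (-1) ^+ (j < l)%N = - (-1) ^+ (l < j)%N :> R.
Proof.
by rewrite -val_eqE /=; case: ltngtP => //= _ _; rewrite expr0 expr1 ?opprK.
Qed.

Section Koszul.
Variables (k : fieldType) (m : nat).
Local Notation A := {mpoly k[m]}.
Implicit Types (S T : {set 'I_m}) (z w : {set 'I_m} -> A).

(** The sign of moving [e_j] from the front to its sorted place among the [e_l] with [l] in [S]. *)
Definition ksign (j : 'I_m) S : A := (-1) ^+ (\sum_(l in S) (l < j))%N.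

(* A function [z] stands for the element [\sum_S z S e_S] of the exterior     *)
(* algebra over [A]; [koszul] contracts it with [\sum_j 'X_j e_j^*] and       *)
(* [derham] is the exterior derivative, with [e_j] in the role of [dX_j].     *)
Definition koszul z S : A :=
  \sum_(j | j \notin S) ksign j S * ('X_j * z (j |: S)).

Definition derham z S : A :=
  \sum_(j in S) ksign j S * (z (S :\ j))^`M(j).

Lemma ksignU j l S : l \notin S ->
  ksign j (l |: S) = (-1) ^+ (l < j)%N * ksign j S.
Proof. by move=> lS; rewrite /ksign big_setU1 //= exprD. Qed.

Lemma ksignD j l S : l \in S ->
  ksign j S = (-1) ^+ (l < j)%N * ksign j (S :\ l).
Proof. by move=> lS; rewrite -{1}(finset.setD1K lS) ksignU // finset.setD11. Qed.

Lemma ksign_sqr j S (x : A) : ksign j S * (ksign j S * x) = x.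
Proof. by rewrite /ksign signrMK. Qed.

Lemma eq_koszul z w : z =1 w -> koszul z =1 koszul w.
Proof. by move=> zw S; apply: eq_bigr => j _; rewrite zw. Qed.

Lemma koszulP (a : A) z w S :
  koszul (fun S => a * z S + w S) S = a * koszul z S + koszul w S.
Proof.
rewrite /koszul mulr_sumr -big_split; apply: eq_bigr => j _ /=.
rewrite 2!mulrDr; congr (_ + _).
by rewrite [RHS]mulrCA ['X_j * (a * _)]mulrCA.
Qed.

Lemma koszulK z S : koszul (koszul z) S = 0.
Proof.
(* The summand of the double contraction, extended by 0 to all pairs; exchanging [j] and [l] flips
   its sign. *)
pose F j l : A := if [&& j \notin S, l \notin S & l != j] then
  ksign j S * ('X_j * (ksign l (j |: S) * ('X_l * z (l |: (j |: S))))) else 0.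
rewrite -[RHS](@sum_antisym _ _ F).
- rewrite /koszul big_mkcond; apply: eq_bigr => j _.
  case jS: (j \notin S); last by rewrite big1 // => l _; rewrite /F jS.
  rewrite !mulr_sumr big_mkcond; apply: eq_bigr => l _.
  by rewrite /F jS in_setU1 negb_or andbC.
- move=> j l; rewrite /F [j == l]eq_sym andbCA.
  case: ifP => [/and3P[lS jS lj]|]; last by rewrite oppr0.
  rewrite !ksignU // finset.setUCA.
  rewrite (sign_lt_anti _ lj); move: (ksign j S) (ksign l S) => a b.
  rewrite !mulNr !mulrN !mulrA.
  by rewrite [in RHS]( *%R.[ACl 4*5*3*1*2*6]).
- by move=> j; rewrite /F eqxx !andbF.
Qed.

Lemma koszul_derham z S :
  koszul (derham z) S + derham (koszul z) S = euler (z S) + #|S|%:R * z S.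
Proof.
pose G j l : A := ksign j S * ('X_j * (ksign l (j |: S) *
  (z (j |: (S :\ l)))^`M(l))).
have kdE : koszul (derham z) S =
    \sum_(j | j \notin S) 'X_j * (z S)^`M(j) +
    \sum_(j | j \notin S) \sum_(l in S) G j l.
  rewrite -big_split; apply: eq_bigr => j jS /=.
  rewrite /derham (big_setU1 _ jS) /= !mulrDr; congr (_ + _).
    rewrite finset.setU1K // ksignU // ltnn mul1r.
    by rewrite ['X_j * (_ * _)]mulrCA ksign_sqr.
  rewrite !mulr_sumr; apply: eq_bigr => l lS.
  rewrite /G; congr (_ * (_ * (_ * (z _)^`M(l)))).
  apply/setP => i; rewrite !inE; case: (eqVneq i j) => [->|] //=.
  by case: (eqVneq j l) => [jl|//]; rewrite jl lS in jS.
have dkE : derham (koszul z) S =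
    \sum_(j in S) ('X_j * (z S)^`M(j) + z S) -
    \sum_(l in S) \sum_(j | j \notin S) G j l.
  rewrite -sumrB; apply: eq_bigr => l lS /=.
  rewrite /koszul (bigD1 l) ?finset.setD11 //= mderivD mulrDr; congr (_ + _).
    rewrite finset.setD1K // (ksignD l lS) ltnn mul1r raddfMsign ksign_sqr.
    rewrite /= mderivM mderivX -{2}[U_(l)%MM]add0m addmK mpolyX0 mnm1E eqxx.
    by rewrite scale1r addrC mul1r.
  rewrite raddf_sum mulr_sumr -sumrN; apply: eq_big => [j|j /andP[]].
    rewrite in_setD1 negb_and negbK.
    by case: eqVneq => [->|_] /=; rewrite ?andbT // lS.
  rewrite in_setD1 negb_and negbK => /orP[/eqP->|jS jl]; first by rewrite eqxx.
  rewrite /G (ksignD j lS) ksignU // (sign_lt_anti _ jl) raddfMsign /= mderivM mderivX.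
  rewrite mnm1E (negPf jl) scale0r mul0r add0r.
  rewrite -/(ksign j (S :\ l)) !mulNr opprK.
  move: (ksign l S) (ksign j (S :\ l)) => a b; move: (z _)^`M(l) 'X_j => y x.
  rewrite -!mulrA ![x * (_ * (_ * _))]mulrCA ![b * (_ * (_ * (_ * _)))]mulrCA.
  by rewrite signrMK [x * (a * _)]mulrCA mulrCA.
rewrite kdE dkE exchange_big /= addrACA subrr addr0.
rewrite big_split /= addrA; congr (_ + _); last by rewrite sumr_const mulr_natl.
by rewrite addrC [RHS](bigID (mem S)).
Qed.

Hypothesis char0 : [pchar k] =i pred0.

(* The induction removes the top total degree [d] from [z] by applying        *)
(* (total degree) - [d], which preserves cycles with coefficients in [N1].     *)
Lemma koszul_exact_bounded (N1 N2 : submodClosed A^o) d z :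
  (forall p, p \in N1 -> euler p \in N1) ->
  (forall p i, p \in N1 -> p^`M(i) \in N2) ->
  (forall S, z S \in N1) -> (forall S, koszul z S = 0) ->
  (forall S n, (z S)@_n != 0 -> (0 < mdeg n + #|S| <= d)%N) ->
  exists2 w, forall S, w S \in N2 & forall S, koszul w S = z S.
Proof.
move=> N1E N1D; elim: d z => [|d IHd] z zN1 zK zd.
  (* For [d = 0] the bounds on the total degree are contradictory, so [z] is 0. *)
  exists (fun=> 0) => S; first exact: rpred0.
  rewrite /koszul big1 => [|j _]; last by rewrite !mulr0.
  apply/mpolyP => n; rewrite mcoeff0; apply/esym/eqP; apply: contraTT isT.
  by move=> /zd; case: (mdeg n + _)%N.
pose c : A := - d.+1%:R.
pose y S := c * z S + (euler (z S) + #|S|%:R * z S).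
have yE S : y S = c * z S + koszul (derham z) S.
  rewrite /y -koszul_derham [derham _ S]big1 ?addr0 // => j _.
  by rewrite zK mderiv0 mulr0.
have [|S|S n yn|w wN2 wE] := IHd y.
- move=> S; apply: rpredD; first exact: mem_ideal_mul.
  by apply: rpredD; [apply: N1E | apply: mem_ideal_mul].
- by rewrite (eq_koszul yE) koszulP zK koszulK mulr0 addr0.
- have yE' : (y S)@_n = ((mdeg n + #|S|)%:R - d.+1%:R) * (z S)@_n.
    rewrite /y /c !mcoeffD mcoeff_euler -!mpolyC_nat -mpolyCN.
    by rewrite !mcoeffCM -!mulrDl addrC natrD.
  have zn : (z S)@_n != 0 by apply: contraNneq yn; rewrite yE' => ->; rewrite mulr0.
  have /andP[-> nd] := zd S n zn; rewrite -ltnS ltn_neqAle nd andbT.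
  by apply: contraNneq yn; rewrite yE' => ->; rewrite subrr mul0r.
have dN0 : d.+1%:R != 0 :> k by move/pcharf0P: char0 => ->.
pose b : A := (d.+1%:R^-1)%:MP.
(* Solving [koszul w = y = c * z + koszul (derham z)] for [z], with [c = - d.+1] invertible in
   characteristic 0. The [+ 0] matches the shape of [koszulP]. *)
exists (fun S => - b * w S + (b * derham z S + 0)) => S.
  apply: rpredD; first exact: mem_ideal_mul.
  rewrite addr0; apply: mem_ideal_mul; apply: rpred_sum => j _.
  exact/mem_ideal_mul/N1D.
rewrite koszulP koszulP wE yE -[koszul (fun=> 0) S](_ : 0 = _) ?addr0; last first.
  by rewrite /koszul big1 // => j _; rewrite !mulr0.
rewrite mulrDr !(@mulNr A) addrNK /c mulrN opprK -mpolyC_nat.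
by rewrite mulrA /b -mpolyCM mulVf // mul1r.
Qed.

Lemma koszul_exact (N1 N2 : submodClosed A^o) z :
  (forall p, p \in N1 -> euler p \in N1) ->
  (forall p i, p \in N1 -> p^`M(i) \in N2) ->
  (forall S, z S \in N1) -> (forall S, koszul z S = 0) ->
  (z finset.set0)@_0 = 0 ->
  exists2 w, forall S, w S \in N2 & forall S, koszul w S = z S.
Proof.
move=> N1E N1D zN1 zK z0.
(* The bound adds the polynomial degree to [#|S| <= m]. Total degree 0 means that [S] is empty and
   [n = 0], which is excluded by hypothesis. *)
apply: (koszul_exact_bounded (d := \max_S msize (z S) + m) N1E N1D) => // S n zn.
apply/andP; split.
  rewrite lt0n addn_eq0 mdeg_eq0 cards_eq0; apply: contra zn.
  by case/andP=> /eqP-> /eqP->; rewrite z0.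
apply: leq_add; last by rewrite -[X in (_ <= X)%N]card_ord max_card.
rewrite -mcoeff_msupp in zn.
exact: leq_trans (ltnW (msize_mdeg_lt zn)) (leq_bigmax _).
Qed.

Definition koszul_basis i : {set {set 'I_m}} :=
  finset (fun S => #|S| == i).

(** The sum has at most one term and is 0 unless [S] is [T] with one element added. *)
Definition koszul_coef S T : A :=
  \sum_(j | (j \notin T) && (j |: T == S)) ksign j T * 'X_j.

Definition koszul_diff i : 'M[A]_(#|koszul_basis i.+1|, #|koszul_basis i|) :=
  \matrix_(l, j) koszul_coef (enum_val l) (enum_val j).

(** Extension by zero from the subsets of size [i] to all subsets, which passes from matrices to
    [koszul]. *)
Definition cochain_ext i (v : 'I_#|koszul_basis i| -> A) S : A :=
  \sum_(l | enum_val l == S) v l.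

Lemma card_enum_val i (l : 'I_#|koszul_basis i|) : #|enum_val l| = i.
Proof. by have := enum_valP l; rewrite inE => /eqP. Qed.

Lemma cochain_extE i (v : 'I_#|koszul_basis i| -> A) l :
  cochain_ext v (enum_val l) = v l.
Proof. by apply: big_pred1 => l' /=; rewrite (inj_eq enum_val_inj). Qed.

Lemma cochain_ext_out i (v : 'I_#|koszul_basis i| -> A) S :
  #|S| != i -> cochain_ext v S = 0.
Proof.
move=> Si; apply: big1 => l /eqP lS.
by rewrite -lS card_enum_val eqxx in Si.
Qed.

Lemma koszul_diffE i w (j : 'I_#|koszul_basis i|) :
  \sum_l koszul_diff i l j * w (enum_val l) = koszul w (enum_val j).
Proof.
under eq_bigr do rewrite mxE.
rewrite -(big_enum_val (fun S => koszul_coef S (enum_val j) * w S)) /=.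
under eq_bigr do rewrite /koszul_coef mulr_suml.
rewrite (exchange_big_dep (fun l => l \notin enum_val j)) /=; last first.
  by move=> S l _ /andP[].
apply: eq_bigr => l lj; rewrite (big_pred1 (l |: enum_val j)) ?mulrA // => S /=.
rewrite lj /= [S == _]eq_sym; case: eqP => [<-|]; last by rewrite andbF.
by rewrite inE cardsU1 lj card_enum_val eqxx.
Qed.

Lemma koszul_ext_eq0 i (v : 'I_#|koszul_basis i.+1| -> A) :
  (forall j, \sum_l koszul_diff i l j * v l = 0) ->
  forall S, koszul (cochain_ext v) S = 0.
Proof.
move=> v0 S; have [Si|Si] := boolP (S \in koszul_basis i).
  rewrite -(enum_rankK_in Si Si) -koszul_diffE -[RHS](v0 (enum_rank_in Si S)).
  by apply: eq_bigr => l _; rewrite cochain_extE.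
rewrite /koszul big1 // => j jS; rewrite cochain_ext_out ?mulr0 //.
by rewrite cardsU1 jS; apply: contra Si; rewrite inE.
Qed.

Lemma koszul_ext0_eq0 (v : 'I_#|koszul_basis 0| -> A) S :
  koszul (cochain_ext v) S = 0.
Proof.
rewrite /koszul big1 // => j jS.
by rewrite cochain_ext_out ?mulr0 // cardsU1 jS.
Qed.

Lemma cochain_ext0 (v : 'I_#|koszul_basis 0| -> A) :
  cochain_ext v finset.set0 = \sum_l v l.
Proof. by apply: eq_bigl => l; rewrite -cards_eq0 card_enum_val. Qed.

Lemma koszul_cochain_exact (N1 N2 : submodClosed A^o) i
    (v : 'I_#|koszul_basis i| -> A) :
  (forall p, p \in N1 -> euler p \in N1) ->
  (forall p i, p \in N1 -> p^`M(i) \in N2) ->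
  (forall l, v l \in N1) -> (forall S, koszul (cochain_ext v) S = 0) ->
  (cochain_ext v finset.set0)@_0 = 0 ->
  exists2 w, forall S, w S \in N2 & forall l, koszul w (enum_val l) = v l.
Proof.
move=> N1E N1D vN1 vK v0.
have [|w wN2 wE] := koszul_exact (z := cochain_ext v) N1E N1D _ vK v0.
  by move=> S; apply: rpred_sum => l _.
by exists w => // l; rewrite wE cochain_extE.
Qed.

Lemma mulmx_koszul_diff i (v : 'rV[A]_#|koszul_basis i.+1|) j :
  (v *m koszul_diff i) 0 j = \sum_l koszul_diff i l j * v 0 l.
Proof. by rewrite mxE; apply: eq_bigr => l _; rewrite mulrC. Qed.

Lemma koszul_row_exact i (v : 'rV[A]_#|koszul_basis i|) :
  (forall S, koszul (cochain_ext (v 0)) S = 0) ->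
  (cochain_ext (v 0) finset.set0)@_0 = 0 ->
  exists u, v = u *m koszul_diff i.
Proof.
(* With the unit ideal for both coefficient ideals, the closure conditions are trivial and exactness
   over [A] results. *)
pose N : submodClosed A^o := ideal_gen setT.
have mN p : p \in N by apply: mem_ideal_gen.
move=> vK v0.
have [//|//|//|w _ wE] := @koszul_cochain_exact N N i (v 0) _ _ _ vK v0.
exists (\row_l w (enum_val l)); apply/rowP => j; rewrite mulmx_koszul_diff.
rewrite -[LHS]wE -koszul_diffE; apply: eq_bigr => l _.
by rewrite [X in _ = _ * X]mxE.
Qed.

(** * The Koszul complex as a free resolution of the residue field *)

Local Open Scope quotient_scope.
Local Notation residue := (@residue_module k m).
Local Notation pi_residue :=
  (\pi_(quotient_module (@irrelevant_ideal k m))).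

(** Only the empty set has size 0, so the sum is the single coordinate of [v]. *)
Definition koszul_aug (v : 'rV[A]_#|koszul_basis 0|) : residue :=
  pi_residue (\sum_l v 0 l).

Fact koszul_aug_is_linear : linear koszul_aug.
Proof.
move=> a u v; rewrite /koszul_aug [X in _ = X + _]quotient_scale_pi -quotient_piD.
rewrite scaler_sumr -big_split; congr (pi_residue _).
by apply: eq_bigr => l _; rewrite !mxE.
Qed.

HB.instance Definition _ := GRing.isLinear.Build A 'rV[A]_#|koszul_basis 0|
  residue _ koszul_aug koszul_aug_is_linear.

Lemma koszul_aug_surj c : exists v, koszul_aug v = c.
Proof.
exists (const_mx (repr c)); rewrite /koszul_aug.
under eq_bigr do rewrite mxE.
rewrite sumr_const card_ord [#|_|](_ : _ = 1%N) ?reprK //.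
rewrite -(cards1 (finset.set0 : {set 'I_m})); apply: eq_card => S.
by rewrite !inE cards_eq0.
Qed.

Lemma koszul_aug_eq0 v : (koszul_aug v = 0) <-> (\sum_l v 0 l)@_0 = 0.
Proof.
have <- : pi_residue 0 = 0 :> residue.
  by apply: (addIr (pi_residue 0)); rewrite -quotient_piD !add0r.
rewrite /koszul_aug; split=> [/eqP|v0]; last apply/eqP.
  by rewrite quotient_eq subr0 irrelevant_idealP => /eqP.
by rewrite quotient_eq subr0 irrelevant_idealP v0.
Qed.

Lemma koszul_aug_exact v :
  koszul_aug v = 0 <-> exists u, v = u *m koszul_diff 0.
Proof.
split=> [/koszul_aug_eq0 v0|[u ->]].
  by apply: koszul_row_exact => [S|]; rewrite ?koszul_ext0_eq0 ?cochain_ext0.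
apply/koszul_aug_eq0; rewrite rmorph_sum big1 // => j _.
rewrite mulmx_koszul_diff rmorph_sum big1 // => l _.
rewrite !mxE rmorphM /= /koszul_coef rmorph_sum big1 ?mul0r // => t _.
by rewrite rmorphM /= mcoeffX mnm1_eq0 mulr0.
Qed.

Lemma koszul_diff_exact i (v : 'rV[A]_#|koszul_basis i.+1|) :
  v *m koszul_diff i = 0 <-> exists u, v = u *m koszul_diff i.+1.
Proof.
split=> [v0|[u ->]].
  apply: koszul_row_exact; last by rewrite cochain_ext_out ?cards0 ?mcoeff0.
  apply: koszul_ext_eq0 => j; have /rowP/(_ j) := v0.
  by rewrite mulmx_koszul_diff mxE.
apply/rowP => j; rewrite mulmx_koszul_diff [RHS]mxE.
pose w : {set 'I_m} -> A := cochain_ext (u 0).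
have wE t : (u *m koszul_diff i.+1) 0 t = koszul w (enum_val t).
  rewrite mulmx_koszul_diff -koszul_diffE.
  by apply: eq_bigr => l _; rewrite /w cochain_extE.
under eq_bigr do rewrite wE.
by rewrite koszul_diffE koszulK.
Qed.

Definition koszul_resolution : free_resolution residue :=
  @FreeResolution _ residue (fun i => #|koszul_basis i|) koszul_diff koszul_aug
    koszul_aug_surj koszul_aug_exact koszul_diff_exact.

(** A cycle over [N1] is the image of a chain over [N2] by [koszul_cochain_exact]; the vanishing of
    constant terms on [N1] excludes total degree 0. *)
Lemma koszul_tor_map_eq0 (N1 N2 : submodClosed A^o)
    (sub12 : {subset N1 <= N2}) i :
  (forall p, p \in N1 -> euler p \in N1) ->
  (forall p i, p \in N1 -> p^`M(i) \in N2) ->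
  (forall p, p \in N1 -> p@_0 = 0) ->
  forall x : tor koszul_resolution (submodule N1) i,
    tor_map (inclusion sub12) x = 0.
Proof.
move=> N1E N1D N10; apply/tor_map_eq0P => z zc.
pose v l : A := val (z l).
have vN1 l : v l \in N1 by apply: valP.
have vK S : koszul (cochain_ext v) S = 0.
  case: i z zc @v vN1 => [|i] z zc v vN1; first exact: koszul_ext0_eq0.
  apply: koszul_ext_eq0 => j.
  have /eqP/ffunP/(_ j)/(congr1 val) : tensor_diff z == 0 by [].
  by rewrite !ffunE submodule_val_sum.
have v0 : (cochain_ext v finset.set0)@_0 = 0.
  by apply: N10; apply: rpred_sum => l _; apply: vN1.
have [w wN2 wE] := koszul_cochain_exact N1E N1D vN1 vK v0.
exists [ffun l => exist (fun p => p \in N2) (w (enum_val l)) (wN2 _)].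
apply/ffunP => j; apply: val_inj; rewrite !ffunE /= -[LHS]wE -koszul_diffE.
by rewrite submodule_val_sum; apply: eq_bigr => l _; rewrite ffunE.
Qed.

End Koszul.

(** * Homogeneous ideals and the conclusion *)

Section HomogeneousIdeal.
Variables (k : fieldType) (m : nat) (I : submodClosed {mpoly k[m]}^o).
Hypothesis homI : homogeneous_ideal I.

(** On a homogeneous generator [euler] is multiplication by the degree. *)
Lemma euler_homogeneous_ideal p : p \in I -> euler p \in I.
Proof.
have [G [homG IG]] := homI; rewrite IG.
have GI g : G g -> g \in I by move=> Gg; rewrite IG; apply: mem_ideal_gen.
apply: (derivation_ideal_gen (@euler_derivation k m)) => // g Gg.
by have [d gd] := homG g Gg; rewrite /euler (euler_homog gd) mem_ideal_mul ?GI.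
Qed.

(** A homogeneous generator with nonzero constant coefficient has degree 0, so it is a unit and
    would put every [f] in [I]. *)
Lemma homogeneous_ideal_irrelevant :
  (exists f, f \notin I) -> {subset I <= @irrelevant_ideal k m}.
Proof.
move=> [f fI]; have [G [homG IG]] := homI => p; rewrite IG.
apply: ideal_gen_min => g Gg; have [d gd] := homG g Gg.
rewrite irrelevant_idealP; apply: contraNT fI => g0.
have d0 : d = 0%N.
  by apply: contraNeq g0 => d0; rewrite (dhomog_nemf_coeff gd) // mf0 eq_sym.
have gE : g = (g@_0)%:MP.
  apply/mpolyP => n; rewrite mcoeffC; case: eqVneq => [->|n0].
    by rewrite mulr1.
  by rewrite mulr0 (dhomog_nemf_coeff gd) // d0 mdeg_eq0.
have -> : f = f * (g@_0)^-1%:MP * g.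
  by rewrite {2}gE -mulrA -mpolyCM mulVf // mulr1.
by apply: mem_ideal_mul; rewrite IG; apply: mem_ideal_gen.
Qed.

End HomogeneousIdeal.

Theorem proposition5p5 (k : fieldType) (m : nat)
    (I : submodClosed {mpoly k[m]}^o) :
  [pchar k] =i pred0 ->
  homogeneous_ideal I ->
  (exists2 f, f \in I & f != 0) ->
  (exists f, f \notin I) ->
  (forall n : nat,
     {subset partial_ideal (symbolic_power I n.+1) <= symbolic_power I n}) /\
  tor_vanishing (J := fun n => symbolic_power I n) (symbolic_powerS (Q := I)).
Proof.
move=> char0 homI _ properI.
have partialI n p i : p \in symbolic_power I n.+1 ->
    p^`M(i) \in symbolic_power I n.
  (* For [n = 0] the target is the whole ring. *)
  case: n => [//|n]; have dd := @mderiv_derivation k m i.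
  apply: (derivation_symbolic_power dd); first exact: ideal_powS.
  exact: derivation_ideal_pow.
split=> [n|F n i x].
  by apply: ideal_gen_min => _ [g [j [gI ->]]]; apply: partialI.
apply: (tor_map_eq0_resolution (F' := koszul_resolution m char0)).
apply: koszul_tor_map_eq0 => [p|p j|p].
- apply: derivation_symbolic_power => //; first exact: euler_derivation.
  apply: derivation_ideal_pow_stable; first exact: euler_derivation.
  exact: euler_homogeneous_ideal.
- exact: partialI.
(* Constant terms vanish on the symbolic power because it lies in a minimal prime [P] below the
   irrelevant ideal; this rests on [I] being proper. *)
- have [P minP Pm] := exists_minimal_prime (@irrelevant_ideal_prime k m)
    (homogeneous_ideal_irrelevant homI properI).
  move=> /(symbolic_power_sub_minimal_prime minP)/Pm.
  by rewrite irrelevant_idealP => /eqP.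
Qed.
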